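(* For every $\top$-convergence group $(X,\cdot,\mathbb{C})$ we have $\mathbb{C}=\mathbb{C}_{\Phi^{\mathbb{C}}}$.
   Context: Throughout, $L=(L,\ast)$ is a complete residuated lattice: $(L,\le)$ is a complete lattice with top $\top$ and bottom $\bot$, and $\ast$ is a commutative associative binary operation on $L$ with $a\ast\bigvee_{j}b_j=\bigvee_j(a\ast b_j)$ and $a\ast\top=a$. Put $a\to b=\bigvee\{c\in L: a\ast c\le b\}$. $L^X$ is the set of all maps $X\to L$, with pointwise order and operations. For $\lambda,\mu\in L^X$, $S_X(\lambda,\mu)=\bigwedge_{x\in X}(\lambda(x)\to\mu(x))$. A $\top$-filter on $X$ is a nonempty $\mathbb{F}\subseteq L^X$ such that: $\bigvee_{x\in X}\lambda(x)=\top$ for all $\lambda\in\mathbb{F}$; $\lambda\wedge\mu\in\mathbb{F}$ for all $\lambda,\mu\in\mathbb{F}$; and for $\lambda\in L^X$, $\bigvee_{\mu\in\mathbb{F}}S_X(\mu,\lambda)=\top$ implies $\lambda\in\mathbb{F}$. $\mathbb{F}_L^\top(X)$ is the set of $\top$-filters on $X$. A $\top$-filter base on $X$ is a nonempty $\mathbb{B}\subseteq L^X$ such that $\bigvee_{x}\lambda(x)=\top$ for all $\lambda\in\mathbb{B}$ and $\bigvee_{\nu\in\mathbb{B}}S_X(\nu,\lambda\wedge\mu)=\top$ for all $\lambda,\mu\in\mathbb{B}$; it generates the $\top$-filter $\{\lambda\in L^X:\bigvee_{\mu\in\mathbb{B}}S_X(\mu,\lambda)=\top\}$. For $x\in X$,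 $[x]_\top=\{\mu\in L^X:\mu(x)=\top\}$ (a $\top$-filter). For a map $f:X\to Y$ and $\mathbb{F}\in\mathbb{F}_L^\top(X)$, $f^\Rightarrow(\mathbb{F})=\{\mu\in L^Y:\mu\circ f\in\mathbb{F}\}\in\mathbb{F}_L^\top(Y)$. For $\mathbb{F},\mathbb{G}\in\mathbb{F}_L^\top(X)$, $\mathbb{F}\times\mathbb{G}$ is the $\top$-filter on $X\times X$ generated by the $\top$-filter base $\{\lambda\times\mu:\lambda\in\mathbb{F},\mu\in\mathbb{G}\}$, where $(\lambda\times\mu)(x_1,x_2)=\lambda(x_1)\wedge\mu(x_2)$. A $\top$-convergence space is a pair $(X,\mathbb{C})$ with $\mathbb{C}:\mathbb{F}_L^\top(X)\to 2^X$, writing $\mathbb{F}\stackrel{\mathbb{C}}{\dashrightarrow}x$ for $x\in\mathbb{C}(\mathbb{F})$, such that (TC1) $[x]_\top\stackrel{\mathbb{C}}{\dashrightarrow}x$ for all $x\in X$; (TC2) $\mathbb{F}\subseteq\mathbb{G}$ and $\mathbb{F}\stackrel{\mathbb{C}}{\dashrightarrow}x$ imply $\mathbb{G}\stackrel{\mathbb{C}}{\dashrightarrow}x$. A map $f:(X,\mathbb{C}_X)\to(Y,\mathbb{C}_Y)$ is continuous if $\mathbb{F}\stackrel{\mathbb{C}_X}{\dashrightarrow}x$ implies $f^\Rightarrow(\mathbb{F})\stackrel{\mathbb{C}_Y}{\dashrightarrow}f(x)$. The product structure $\mathbb{C}\times\mathbb{C}$ on $X\times X$ is given by $\mathbb{F}\stackrel{\mathbb{C}\times\mathbb{C}}{\dashrightarrow}(x_1,x_2)$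 iff $p_i^\Rightarrow(\mathbb{F})\stackrel{\mathbb{C}}{\dashrightarrow}x_i$ for $i=1,2$, where $p_1,p_2$ are the projections. For a group $(X,\cdot)$ and a $\top$-convergence space $(X,\mathbb{C})$, the triple $(X,\cdot,\mathbb{C})$ is a $\top$-convergence group if $m:(X\times X,\mathbb{C}\times\mathbb{C})\to(X,\mathbb{C})$, $(x,y)\mapsto xy$, and $r:(X,\mathbb{C})\to(X,\mathbb{C})$, $x\mapsto x^{-1}$, are continuous. Let $e$ be the identity of the group $X$. For $\lambda\in L^X$, $\lambda_l\in L^{X\times X}$ is $\lambda_l(x,y)=\lambda(x^{-1}y)$. For $\mathbb{G}\in\mathbb{F}_L^\top(X)$, $\mathbb{G}_l$ is the $\top$-filter on $X\times X$ generated by the $\top$-filter base $\{\lambda_l:\lambda\in\mathbb{G}\}$. For a $\top$-convergence group $(X,\cdot,\mathbb{C})$, the set $\Phi^{\mathbb{C}}\subseteq\mathbb{F}_L^\top(X\times X)$ is defined by: $\mathbb{F}\in\Phi^{\mathbb{C}}$ iff there exists $\mathbb{G}\in\mathbb{F}_L^\top(X)$ with $\mathbb{G}\stackrel{\mathbb{C}}{\dashrightarrow}e$ and $\mathbb{F}\supseteq\mathbb{G}_l$. (This $\Phi^{\mathbb{C}}$ is a $\top$-uniformly convergence structure on $X$, i.e. a set of $\top$-filters on $X\times X$ containing every $[(x,x)]_\top$, closed under larger $\top$-filters, under composition of $\top$-filters when it exists, and under inversion $(x,y)\mapsto(y,x)$.) For a $\top$-uniformly convergence structure $\Phi\subseteq\mathbb{F}_L^\top(X\times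 X)$, $\mathbb{C}_\Phi$ is the $\top$-convergence structure on $X$ given by $\mathbb{F}\stackrel{\mathbb{C}_\Phi}{\dashrightarrow}x$ iff $[x]_\top\times\mathbb{F}\in\Phi$, for $\mathbb{F}\in\mathbb{F}_L^\top(X)$, $x\in X$. *)

(* Defs.v *)
From HB Require Import structures.
From mathcomp Require Import all_boot all_order.
From mathcomp Require Import boolp classical_sets.

Set Implicit Arguments.
Unset Strict Implicit.
Unset Printing Implicit Defensive.

Import Order.TTheory.
Local Open Scope classical_set_scope.
Local Open Scope order_scope.

HB.mixin Record TBLattice_isComplete (d : Order.disp_t) L
    of Order.TBLattice d L := {
  csup : set L -> L ;
  csup_isLub : forall A : set L, isLub A (csup A)
}.

#[short(type="completeLatticeType")]
HB.structure Definition CompleteLattice (d : Order.disp_t) :=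
  {L of Order.TBLattice d L & TBLattice_isComplete d L}.

HB.mixin Record CompleteLattice_isResiduated (d : Order.disp_t) L
    of CompleteLattice d L := {
  tens : L -> L -> L ;
  tensC : commutative tens ;
  tensA : associative tens ;
  tens_csup : forall (a : L) (B : set L),
    tens a (csup B) = csup [set tens a b | b in B] ;
  tensx1 : right_id (\top : L) tens
}.

#[short(type="completeResiduatedLatticeType")]
HB.structure Definition CompleteResiduatedLattice (d : Order.disp_t) :=
  {L of CompleteLattice d L & CompleteLattice_isResiduated d L}.

Section CompleteLatticeTheory.
Context {d : Order.disp_t} {L : completeLatticeType d}.
Implicit Types (A B : set L) (a b : L).

Definition cinf A : L := csup (lbound A).

Lemma csup_ge A a : A a -> a <= csup A.
Proof. by have [+ _] := csup_isLub A; apply. Qed.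

Lemma csup_le A b : (forall a, A a -> a <= b) -> csup A <= b.
Proof. by have [_ +] := csup_isLub A; apply. Qed.

Lemma cinf_le A a : A a -> cinf A <= a.
Proof. by move=> Aa; apply: csup_le => b; apply. Qed.

Lemma cinf_ge A b : (forall a, A a -> b <= a) -> b <= cinf A.
Proof. by move=> lbA; apply: csup_ge. Qed.

Lemma csup_eq_top A b : csup A = \top -> (forall a, A a -> a <= b) -> b = \top.
Proof. by move=> As Ab; apply/eqP; rewrite -le1x -As; exact: csup_le. Qed.

End CompleteLatticeTheory.

Section ResiduatedTheory.
Context {d : Order.disp_t} {L : completeResiduatedLatticeType d}.
Implicit Types a b c : L.

Definition residual a b : L := csup [set c | tens a c <= b].

Lemma le_tens2l a b c : b <= c -> tens a b <= tens a c.
Proof.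
move=> bc; have -> : c = csup [set b; c].
  apply/le_anti/andP; split; first by apply: csup_ge; right.
  by apply: csup_le => x [->|->].
by rewrite tens_csup; apply: csup_ge; exists b => //; left.
Qed.

Lemma le_tens a a' b b' : a <= a' -> b <= b' -> tens a b <= tens a' b'.
Proof.
move=> aa' bb'; apply: (le_trans (le_tens2l a bb')).
by rewrite tensC (tensC a'); exact: le_tens2l.
Qed.

Lemma tens_lel a b : tens a b <= a.
Proof. by rewrite -[leRHS]tensx1; apply: le_tens2l; exact: lex1. Qed.

Lemma tens_ler a b : tens a b <= b.
Proof. by rewrite tensC; exact: tens_lel. Qed.

Lemma tens1x a : tens \top a = a.
Proof. by rewrite tensC tensx1. Qed.

Lemma tens_residual a b : tens a (residual a b) <= b.
Proof. by rewrite tens_csup; apply: csup_le => _ [c ? <-]. Qed.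

Lemma residualP a b c : (c <= residual a b) = (tens a c <= b).
Proof.
apply/idP/idP => [h|h]; last exact: csup_ge.
exact: le_trans (le_tens2l a h) (tens_residual a b).
Qed.

End ResiduatedTheory.

Section SubsethoodDegree.
Context {d : Order.disp_t} {L : completeResiduatedLatticeType d} {X : Type}.
Implicit Types lam mu nu : X -> L.

Definition fmeet lam mu : X -> L := fun x => lam x `&` mu x.

Definition subdeg lam mu : L := cinf (range (fun x => residual (lam x) (mu x))).

Lemma subdegP a lam mu :
  a <= subdeg lam mu <-> forall x, tens (lam x) a <= mu x.
Proof.
split=> [h x|h].
  rewrite -residualP; apply: (le_trans h); apply: cinf_le.
  by exists x.
by apply: cinf_ge => _ [x _ <-]; rewrite residualP.
Qed.

Lemma subdeg_tens lam mu x : tens (lam x) (subdeg lam mu) <= mu x.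
Proof. by move: x; apply/subdegP. Qed.

Lemma subdeg_trans lam mu nu :
  tens (subdeg lam mu) (subdeg mu nu) <= subdeg lam nu.
Proof.
apply/subdegP => x; rewrite tensA; apply: le_trans (subdeg_tens mu nu x).
by apply: le_tens => //; exact: subdeg_tens.
Qed.

Lemma subdeg_top lam mu : (forall x, lam x <= mu x) -> subdeg lam mu = \top.
Proof.
by move=> h; apply/eqP; rewrite -le1x; apply/subdegP => x; rewrite tensx1.
Qed.

Lemma subdeg_meet lam mu lam' mu' :
  tens (subdeg lam lam') (subdeg mu mu') <=
  subdeg (fmeet lam mu) (fmeet lam' mu').
Proof.
apply/subdegP => x; rewrite lexI; apply/andP; split.
  by apply: le_trans (subdeg_tens lam lam' x);
    apply: le_tens; [exact: leIl | exact: tens_lel].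
by apply: le_trans (subdeg_tens mu mu' x);
  apply: le_tens; [exact: leIr | exact: tens_ler].
Qed.

End SubsethoodDegree.

Lemma csup_tens_top {d : Order.disp_t} {L : completeResiduatedLatticeType d}
    (A B : set L) (z : L) :
  csup A = \top -> csup B = \top ->
  (forall a b, A a -> B b -> tens a b <= z) -> z = \top.
Proof.
move=> As Bs h; apply: (csup_eq_top As) => a Aa.
rewrite -[a]tensx1 -Bs tens_csup; apply: csup_le => _ [b Bb <-].
exact: h.
Qed.

(* A T-filter on X is a family of maps X -> L, bundled with its axioms; proofs
   are irrelevant, so two T-filters are equal as soon as the families are
   (tfilter_ext). *)
Section TopFilter.
Context {d : Order.disp_t} (L : completeResiduatedLatticeType d) (X : Type).

Record tfilter := TFilter {
  tfilter_set :> (X -> L) -> Prop ;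
  tfilter_nonempty : tfilter_set !=set0 ;
  tfilter_sup : forall lam, tfilter_set lam -> csup (range lam) = \top ;
  tfilter_meet : forall lam mu,
    tfilter_set lam -> tfilter_set mu -> tfilter_set (fmeet lam mu) ;
  tfilter_sat : forall lam,
    csup [set subdeg mu lam | mu in tfilter_set] = \top -> tfilter_set lam
}.

Record tfilter_base (B : set (X -> L)) : Prop := TFilterBase {
  tbase_nonempty : B !=set0 ;
  tbase_sup : forall lam, B lam -> csup (range lam) = \top ;
  tbase_meet : forall lam mu, B lam -> B mu ->
    csup [set subdeg nu (fmeet lam mu) | nu in B] = \top
}.

End TopFilter.

Section TopFilterTheory.
Context {d : Order.disp_t} {L : completeResiduatedLatticeType d}.

Lemma tfilter_ext (X : Type) (F G : tfilter L X) :
  (F : set (X -> L)) = G -> F = G.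
Proof.
case: F G => [F F1 F2 F3 F4] [G G1 G2 G3 G4] /= FG; rewrite -FG in G1 G2 G3 G4 *.
by congr TFilter; exact: Prop_irrelevance.
Qed.

Lemma tfilter_up (X : Type) (F : tfilter L X) (lam mu : X -> L) :
  F lam -> (forall x, lam x <= mu x) -> F mu.
Proof.
move=> Flam h; apply: tfilter_sat; apply/eqP; rewrite -le1x.
by rewrite -(subdeg_top h); apply: csup_ge; exists lam.
Qed.

Section Generated.
Context {X : Type} (B : set (X -> L)) (Bbase : tfilter_base B).

Definition tgenerated_set : set (X -> L) := [set lam | csup [set subdeg mu lam | mu in B] = \top].

Lemma tgenerated_incl lam : B lam -> tgenerated_set lam.
Proof.
move=> Blam; apply/eqP; rewrite -le1x -(@subdeg_top _ _ _ lam lam) //.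
by apply: csup_ge; exists lam.
Qed.

Lemma tgenerated_nonempty : tgenerated_set !=set0.
Proof. by have [lam Blam] := tbase_nonempty Bbase; exists lam; exact: tgenerated_incl. Qed.

Lemma tgenerated_sup lam : tgenerated_set lam -> csup (range lam) = \top.
Proof.
move=> glam; apply: (csup_eq_top glam) => _ [mu Bmu <-].
rewrite -[leLHS]tensx1 -(tbase_sup Bbase Bmu) tens_csup.
apply: csup_le => _ [_ [x _ <-] <-]; rewrite tensC.
by apply: le_trans (subdeg_tens mu lam x) _; apply: csup_ge; exists x.
Qed.

Lemma tgenerated_meet lam mu : tgenerated_set lam -> tgenerated_set mu -> tgenerated_set (fmeet lam mu).
Proof.
move=> glam gmu; apply: (csup_tens_top glam gmu).
move=> _ _ [lam' Blam' <-] [mu' Bmu' <-].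
apply: (le_trans (subdeg_meet _ _ _ _)).
rewrite -[leLHS]tensx1 -(tbase_meet Bbase Blam' Bmu') tens_csup.
apply: csup_le => _ [_ [nu Bnu <-] <-]; rewrite tensC.
by apply: le_trans (subdeg_trans _ _ _) _; apply: csup_ge; exists nu.
Qed.

Lemma tgenerated_sat lam : csup [set subdeg mu lam | mu in tgenerated_set] = \top -> tgenerated_set lam.
Proof.
move=> h; apply: (csup_eq_top h) => _ [mu gmu <-].
rewrite -[leLHS]tensx1 -gmu tens_csup.
apply: csup_le => _ [_ [nu Bnu <-] <-]; rewrite tensC.
by apply: le_trans (subdeg_trans _ _ _) _; apply: csup_ge; exists nu.
Qed.

Definition tgenerated : tfilter L X :=
  TFilter tgenerated_nonempty tgenerated_sup tgenerated_meet tgenerated_sat.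

End Generated.

Lemma tfilter_base_meet_closed (X : Type) (B : set (X -> L)) :
  B !=set0 -> (forall lam, B lam -> csup (range lam) = \top) ->
  (forall lam mu, B lam -> B mu -> B (fmeet lam mu)) -> tfilter_base B.
Proof.
move=> B0 Bs Bm; split => // lam mu Blam Bmu; apply/eqP; rewrite -le1x.
rewrite -(@subdeg_top _ _ _ (fmeet lam mu) (fmeet lam mu)) //.
by apply: csup_ge; exists (fmeet lam mu) => //; exact: Bm.
Qed.

Section PointFilter.
Context {X : Type} (x : X).

Definition tpoint_set : set (X -> L) := [set mu | mu x = \top].

Lemma tpoint_nonempty : tpoint_set !=set0.
Proof. by exists (fun=> \top). Qed.

Lemma tpoint_sup lam : tpoint_set lam -> csup (range lam) = \top.
Proof.
by move=> h; apply/eqP; rewrite -le1x -h; apply: csup_ge; exists x.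
Qed.

Lemma tpoint_meet lam mu : tpoint_set lam -> tpoint_set mu -> tpoint_set (fmeet lam mu).
Proof. by rewrite /tpoint_set /fmeet /= => -> ->; rewrite meetxx. Qed.

Lemma tpoint_sat lam : csup [set subdeg mu lam | mu in tpoint_set] = \top -> tpoint_set lam.
Proof.
move=> h; apply: (csup_eq_top h) => _ [mu mux <-].
by have := subdeg_tens mu lam x; rewrite mux tens1x.
Qed.

Definition tpoint : tfilter L X := TFilter tpoint_nonempty tpoint_sup tpoint_meet tpoint_sat.

End PointFilter.

Section ImageFilter.
Context {X Y : Type} (f : X -> Y) (F : tfilter L X).

Definition timage_set : set (Y -> L) := [set mu : Y -> L | F (mu \o f)].

Lemma timage_nonempty : timage_set !=set0.
Proof.
have [lam Flam] := tfilter_nonempty F; exists (fun=> \top).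
by apply: (tfilter_up Flam) => x; exact: lex1.
Qed.

Lemma timage_sup lam : timage_set lam -> csup (range lam) = \top.
Proof.
move=> /tfilter_sup h; apply: (csup_eq_top h) => _ [x _ <-].
by apply: csup_ge; exists (f x).
Qed.

Lemma timage_meet lam mu : timage_set lam -> timage_set mu -> timage_set (fmeet lam mu).
Proof. exact: tfilter_meet. Qed.

Lemma timage_sat lam : csup [set subdeg mu lam | mu in timage_set] = \top -> timage_set lam.
Proof.
move=> h; apply: tfilter_sat; apply: (csup_eq_top h) => _ [mu imu <-].
apply: (@le_trans _ _ (subdeg (mu \o f) (lam \o f))).
  by apply/subdegP => x /=; exact: subdeg_tens.
by apply: csup_ge; exists (mu \o f).
Qed.

Definition timage : tfilter L Y := TFilter timage_nonempty timage_sup timage_meet timage_sat.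

End ImageFilter.

Section ProductFilter.
Context {X : Type} (F G : tfilter L X).

Definition fcross (lam mu : X -> L) : X * X -> L :=
  fun z => lam z.1 `&` mu z.2.

Lemma tprod_base : tfilter_base [set fcross lam mu | lam in F & mu in G].
Proof.
apply: tfilter_base_meet_closed.
- have [lam Flam] := tfilter_nonempty F; have [mu Gmu] := tfilter_nonempty G.
  by exists (fcross lam mu), lam => //; exists mu.
- move=> _ [lam Flam [mu Gmu <-]].
  apply: (csup_tens_top (tfilter_sup Flam) (tfilter_sup Gmu)).
  move=> _ _ [x _ <-] [y _ <-].
  apply: (@le_trans _ _ (fcross lam mu (x, y))).
    by rewrite lexI tens_lel tens_ler.
  by apply: csup_ge; exists (x, y).
- move=> _ _ [lam Flam [mu Gmu <-]] [lam' Flam' [mu' Gmu' <-]].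
  exists (fmeet lam lam'); first exact: tfilter_meet.
  exists (fmeet mu mu'); first exact: tfilter_meet.
  by apply/funext => -[x y]; rewrite /fcross /fmeet /= meetACA.
Qed.

Definition tprod : tfilter L (X * X) := tgenerated tprod_base.

End ProductFilter.

Section LeftFilter.
Context {X : groupType}.

Definition fleft (lam : X -> L) : X * X -> L := fun z => lam (z.1^-1 * z.2)%g.

Lemma tleft_base (G : tfilter L X) : tfilter_base [set fleft lam | lam in G].
Proof.
apply: tfilter_base_meet_closed.
- by have [lam Glam] := tfilter_nonempty G; exists (fleft lam), lam.
- move=> _ [lam Glam <-].
  apply: (csup_eq_top (tfilter_sup Glam)) => _ [x _ <-].
  by apply: csup_ge; exists (1%g, x) => //; rewrite /fleft /= invg1 mul1g.
- move=> _ _ [lam Glam <-] [mu Gmu <-].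
  by exists (fmeet lam mu) => //; exact: tfilter_meet.
Qed.

Definition tleft (G : tfilter L X) : tfilter L (X * X) :=
  tgenerated (tleft_base G).

End LeftFilter.

End TopFilterTheory.

Section TopConvergence.
Context {d : Order.disp_t} {L : completeResiduatedLatticeType d}.

(* tconv_lim C F x reads "F converges to x in C". *)
Record tconv (X : Type) := TConv {
  tconv_lim :> tfilter L X -> set X ;
  tconv_point : forall x, tconv_lim (tpoint x) x ;
  tconv_mono : forall (F G : tfilter L X) x,
    F `<=` G -> tconv_lim F x -> tconv_lim G x
}.

Definition tcontinuous (X Y : Type) (CX : tconv X) (CY : tconv Y) (f : X -> Y) :=
  forall (F : tfilter L X) (x : X), CX F x -> CY (timage f F) (f x).

Section ProductConvergence.
Context {X : Type} (C : tconv X).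

Definition tconv_prod_lim (F : tfilter L (X * X)) : set (X * X) :=
  [set z | C (timage fst F) z.1 /\ C (timage snd F) z.2].

Lemma tconv_prod_lim_point z : tconv_prod_lim (tpoint z) z.
Proof.
split.
  have -> : timage fst (tpoint z) = tpoint z.1 :> tfilter L X
    by exact: tfilter_ext.
  exact: tconv_point.
have -> : timage snd (tpoint z) = tpoint z.2 :> tfilter L X
  by exact: tfilter_ext.
exact: tconv_point.
Qed.

Lemma tconv_prod_lim_mono (F G : tfilter L (X * X)) z : F `<=` G -> tconv_prod_lim F z -> tconv_prod_lim G z.
Proof.
move=> FG [h1 h2]; split; [apply: tconv_mono h1|apply: tconv_mono h2];
by move=> mu; exact: FG.
Qed.

Definition tconv_prod : tconv (X * X) := TConv tconv_prod_lim_point tconv_prod_lim_mono.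

End ProductConvergence.

Definition is_tconv_group (X : groupType) (C : tconv X) : Prop :=
  tcontinuous (tconv_prod C) C (fun z : X * X => (z.1 * z.2)%g) /\
  tcontinuous C C (fun x : X => x^-1%g).

Definition unif_of_conv (X : groupType) (C : tconv X) :
    set (tfilter L (X * X)) :=
  [set F | exists G : tfilter L X, C G 1%g /\ tleft G `<=` F].

Definition conv_of_unif (X : Type) (Phi : set (tfilter L (X * X))) :
    tfilter L X -> set X :=
  fun F => [set x | Phi (tprod (tpoint x) F)].

End TopConvergence.

Arguments tconv {d} L X.

(* Main.v *)
Require Import Defs.
From mathcomp Require Import all_boot all_order.
From mathcomp Require Import boolp classical_sets.

(** Write [x . -] for the left translation by x. The filter [x]_T x F is just
    the image of F under y |-> (x, y) ([tprod_tpoint]), because the indicator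
    of x belongs to [x]_T. Restricting lam_l to the slice over x gives
    y |-> lam (x^-1 y), so G_l is contained in [x]_T x F exactly when G is
    contained in the image of F under [x^-1 . -]
    ([tleft_sub_tprod_tpoint]). Convergence passes to larger filters, so some
    G converging to e satisfies this iff that image itself converges to e. In
    a T-convergence group left translations are continuous and have continuous
    inverses ([tcontinuous_mulgl], [tconv_mulgl]), so the latter means that F
    converges to x. *)

Set Implicit Arguments.
Unset Strict Implicit.
Unset Printing Implicit Defensive.

Import Order.TTheory.
Local Open Scope classical_set_scope.
Local Open Scope order_scope.

Section Filters.
Context {d : Order.disp_t} {L : completeResiduatedLatticeType d}.

(** A T-filter is saturated, so inclusion of a generated T-filter in it need
    only be tested on the base. *)
Lemma tgenerated_sub (X : Type) (B : set (X -> L)) (Bbase : tfilter_base B)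
    (F : tfilter L X) :
  tgenerated Bbase `<=` F <-> B `<=` F.
Proof.
split=> [BF lam Blam|BF lam lamB]; first exact/BF/tgenerated_incl.
apply: tfilter_sat; apply: (csup_eq_top lamB) => _ [mu Bmu <-].
by apply: csup_ge; exists mu => //; exact: BF.
Qed.

(** The inclusion from right to left holds because the product of the
    indicator of x with the slice nu (x, -) lies below nu. *)
Lemma tprod_tpoint (X : Type) (x : X) (F : tfilter L X) :
  tprod (tpoint x) F = timage (pair x) F.
Proof.
apply: tfilter_ext; apply/seteqP; split=> [|nu Fnu].
  apply/tgenerated_sub => _ [lam lamx [mu Fmu <-]].
  apply: (tfilter_up Fmu) => y.
  by rewrite /fcross /= (lamx : lam x = \top) meet1x.
pose ind z : L := if `[< z = x >] then \top else \bot.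
apply: (@tfilter_up _ _ _ _ (fcross ind (nu \o pair x))).
  apply: tgenerated_incl; exists ind; last by exists (nu \o pair x).
  by rewrite /= /tpoint_set /= /ind asboolT.
move=> [z y]; rewrite /fcross /ind /=.
by case: asboolP => [->|_]; rewrite ?meet1x // meet0x le0x.
Qed.

Lemma tleft_sub_tprod_tpoint (X : groupType) (G F : tfilter L X) (x : X) :
  tleft G `<=` tprod (tpoint x) F <->
  G `<=` timage (fun y => x^-1 * y)%g F.
Proof.
rewrite tprod_tpoint; apply: (iff_trans (tgenerated_sub _ _)).
split=> [GF lam Glam|GF _ [lam Glam <-]]; last exact: GF.
by apply: (GF (fleft lam)); exists lam.
Qed.

End Filters.

Section ConvergenceGroups.
Context {d : Order.disp_t} {L : completeResiduatedLatticeType d}.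
Context {X : groupType} (C : tconv L X) (HC : is_tconv_group C).

(** Translation by a is multiplication restricted to the slice over a, and the
    image of F under y |-> (a, y) converges to (a, x): its first projection
    contains [a]_T and its second projection is F. *)
Lemma tcontinuous_mulgl (a : X) : tcontinuous C C (fun y => a * y)%g.
Proof.
move=> F x Fx; have [mulC _] := HC.
have /mulC : tconv_prod C (timage (pair a) F) (a, x).
  split; last by apply: tconv_mono Fx => lam.
  apply: tconv_mono (tconv_point C a) => lam lama.
  have [mu Fmu] := tfilter_nonempty F.
  by apply: (tfilter_up Fmu) => y; rewrite /= (lama : lam a = \top) lex1.
by apply: tconv_mono => lam.
Qed.

Lemma tconv_mulgl (a : X) (F : tfilter L X) (x : X) :
  C (timage (fun y => a * y)%g F) (a * x)%g <-> C F x.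
Proof.
split=> [aF|]; last exact: tcontinuous_mulgl.
have := tcontinuous_mulgl a^-1%g aF; rewrite mulKg; apply: tconv_mono => lam.
rewrite /= /timage_set /= /timage_set /=.
by congr (F _); apply/funext => y /=; rewrite mulKg.
Qed.

End ConvergenceGroups.

Theorem theorem5p7 (d : Order.disp_t) (L : completeResiduatedLatticeType d)
    (X : groupType) (C : tconv L X) (HC : is_tconv_group C) :
  tconv_lim C = conv_of_unif (unif_of_conv C).
Proof.
apply/funext => F; apply/seteqP; split=> x.
  move=> /(tconv_mulgl HC x^-1); rewrite mulVg => Fe.
  by exists (timage (fun y => x^-1 * y)%g F); split=> //; exact/tleft_sub_tprod_tpoint.
move=> [G [Ge /tleft_sub_tprod_tpoint GF]].
by apply/(tconv_mulgl HC x^-1); rewrite mulVg; exact: tconv_mono Ge.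
Qed.
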